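(* Let $n\ge 1$. For all $0\le i,j\le n$, $$L_n[i,j]=\sum_{\alpha\in Q^I_{i,j}}\ \prod_{r=j}^{i-1}t_{r+1,\alpha_{i-r}}.$$
   Context: Let $t_{a,b}$ be real scalars for integers $a>b\ge 0$. Rows and columns of $(n+1)\times(n+1)$ matrices are indexed by $0,\dots,n$. Let $\mathcal{P}^{L_n}_{i,j}$ be the set of sequences of points $(k,y_k)$, $k=0,\dots,n$, with $y_k\in\{0,\dots,n\}$, $y_0=i$, $y_n=j$, $y_{k+1}\in\{y_k,y_k-1\}$ for $k<n$, and such that $y_{k+1}=y_k-1$ implies $y_k\ge n-k$. A fall step from $(k,y)$ to $(k+1,y-1)$ has weight $t_{y,k+y-n}$, and a horizontal step from $(k,y)$ to $(k+1,y)$ has weight $1$; the weight $\omega(p)$ of $p\in\mathcal{P}^{L_n}_{i,j}$ is the product of the weights of its steps. $L_n$ is the $(n+1)\times(n+1)$ matrix with $L_n[i,j]=\sum_{p\in\mathcal{P}^{L_n}_{i,j}}\omega(p)$. For $i>j$, $Q^I_{i,j}$ is the set of (weakly) increasing integer sequences $\alpha=(\alpha_1,\dots,\alpha_{i-j})$ of length $i-j$ with $0\le\alpha_r\le i-r$ for every $r$. Also $Q^I_{i,i}=\{\varepsilon\}$ where $\varepsilon$ is the empty sequence, and $Q^I_{i,j}=\emptyset$ for $i<j$. Empty products equal $1$ and empty sums equal $0$. *)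

(* Defs.v *)
From mathcomp Require Import all_boot all_order all_algebra.
From mathcomp Require Import reals.

Set Implicit Arguments.
Unset Strict Implicit.
Unset Printing Implicit Defensive.

Import GRing.Theory.

(* A sequence of points (k, y_k), k = 0, ..., n, with y_k in {0, ..., n},
   is encoded by the finite function k |-> y_k. *)
Definition heights (n : nat) := {ffun 'I_n.+1 -> 'I_n.+1}.

(* y_k and y_(k+1), for k < n *)
Definition hsrc (n : nat) (y : heights n) (k : 'I_n) : nat :=
  y (widen_ord (leqnSn n) k).
Definition htgt (n : nat) (y : heights n) (k : 'I_n) : nat :=
  y (lift ord0 k).

Definition horizontal (n : nat) (y : heights n) (k : 'I_n) : bool :=
  htgt y k == hsrc y k.

(* y_(k+1) = y_k - 1 as integers, hence the form free of truncated
   subtraction. *)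
Definition fall (n : nat) (y : heights n) (k : 'I_n) : bool :=
  (htgt y k).+1 == hsrc y k.

Definition Lpaths (n : nat) (i j : 'I_n.+1) : {set heights n} :=
  [set y : heights n |
    [&& y ord0 == i, y ord_max == j,
        [forall k : 'I_n, horizontal y k || fall y k]
      & [forall k : 'I_n, fall y k ==> (n - k <= hsrc y k)]]].

Local Open Scope ring_scope.

(* The scalars t a b are meaningful only for a > b. On a path, a fall step has
   n - k <= y_k and k < n, so that k + y_k - n is not truncated and is smaller
   than y_k. *)
Definition step_weight (R : realType) (t : nat -> nat -> R) (n : nat)
    (y : heights n) (k : 'I_n) : R :=
  if fall y k then t (hsrc y k) (k + hsrc y k - n)%N else 1.

Definition path_weight (R : realType) (t : nat -> nat -> R) (n : nat)
    (y : heights n) : R :=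
  \prod_(k < n) step_weight t y k.

Definition Lmx (R : realType) (t : nat -> nat -> R) (n : nat) : 'M[R]_n.+1 :=
  \matrix_(i, j) \sum_(p in Lpaths i j) path_weight t p.

Local Close Scope ring_scope.

(* 1-based access: entry a r is a_r, for 1 <= r <= m. *)
Definition entry (i m : nat) (a : m.-tuple 'I_i) (r : nat) : nat :=
  nth 0 [seq val x | x <- a] r.-1.

(* Since a_r <= i - r and r >= 1, all entries are smaller than i: taking them
   in 'I_i is no restriction. For i = j the only element is the empty tuple;
   the test j <= i makes the set empty for i < j, where i - j is truncated. *)
Definition QI (i j : nat) : {set (i - j).-tuple 'I_i} :=
  [set a : (i - j).-tuple 'I_i |
    [&& j <= i, sorted leq [seq val x | x <- a]
      & [forall s : 'I_(i - j), entry a s.+1 <= i - s.+1]]].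

(* Main.v *)
Require Import Defs.
From mathcomp Require Import all_boot all_order all_algebra.
From mathcomp Require Import reals.
From mathcomp Require Import zify.

Set Implicit Arguments.
Unset Strict Implicit.
Unset Printing Implicit Defensive.

Import GRing.Theory.

Local Open Scope ring_scope.

(** Record a path from height [i] to height [j] by its falls. If the [s]-th
fall, from height [y = i - s + 1], takes place at abscissa [k], let
[alpha_s = k + y - n]. Consecutive falls increase [k] by at least one and
decrease [y] by exactly one, so [alpha] is weakly increasing; the bounds
[n - y <= k < n] become [0 <= alpha_s <= i - s]; and the weight of the fall is
[t y alpha_s]. The theorem expresses that this correspondence is a bijection
that preserves weights.

Instead of building the bijection, the proof shows that both sides obey the
same recursion. Let [d] be the number of remaining steps, so that a fall from
[y] made now contributes the value [y - d]. On the path side, the current step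
is either horizontal, leaving [(d - 1, y)], or a fall, leaving
[(d - 1, y - 1)] with factor [t y (y - d)] ([path_sumS], [sum_edge]). On the
side of sequences, those with heights counted down from [y] and entries at
least [lo = y - d] either have all their entries at least
[lo + 1 = y - (d - 1)], or start with [lo], leaving a sequence with heights
counted down from [y - 1] and entries at least [lo = (y - 1) - (d - 1)]
([increasing_sum_split]). The induction on [d] is [path_sum_edge]; the theorem
is the case [d = n], where the lower bound [i - n] is 0. *)

Section PathSums.

Variables (R : comPzSemiRingType) (T : finType) (w : nat -> T -> T -> R).

(** The weight of a step depends on the number of steps that remain, the step
itself included, rather than on its abscissa: removing the first step then
leaves [w] unchanged, and [path_sumS] needs no shift. *)
Definition path_sum (d : nat) (x z : T) : R :=
  \sum_(p : {ffun 'I_d.+1 -> T} | (p ord0 == x) && (p ord_max == z))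
    \prod_(k < d) w (d - k) (p (widen_ord (leqnSn d) k)) (p (lift ord0 k)).

Definition path_cons (d : nat) (x : T) (q : {ffun 'I_d.+1 -> T}) :
    {ffun 'I_d.+2 -> T} :=
  [ffun k => if unlift ord0 k is Some k' then q k' else x].

Lemma path_cons0 d x (q : {ffun 'I_d.+1 -> T}) : path_cons x q ord0 = x.
Proof. by rewrite ffunE unlift_none. Qed.

Lemma path_consS d x (q : {ffun 'I_d.+1 -> T}) k :
  path_cons x q (lift ord0 k) = q k.
Proof. by rewrite ffunE liftK. Qed.

Lemma path_sum0 x z : path_sum 0 x z = (x == z)%:R.
Proof.
rewrite /path_sum; under eq_bigr do rewrite big_ord0.
have -> : ord_max = ord0 :> 'I_1 by apply/val_inj.
case: eqVneq => [<-|xz].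
  rewrite (big_pred1 [ffun=> x]) // => p; rewrite andbb.
  apply/eqP/eqP => [px|->]; last by rewrite ffunE.
  by apply/ffunP => k; rewrite ffunE ord1.
by rewrite big_pred0 // => p; apply/negbTE; apply: contra_neqN xz => /andP[/eqP<-/eqP].
Qed.

(** Paths are classified by their second vertex. *)
Lemma path_sumS d x z :
  path_sum d.+1 x z = \sum_y w d.+1 x y * path_sum d y z.
Proof.
rewrite /path_sum (reindex_onto (@path_cons d x)
  (fun p => [ffun k => p (lift ord0 k)])) /=; last first.
  move=> p /andP[/eqP px _]; apply/ffunP => k; rewrite ffunE.
  by case: unliftP => [k'|] ->; rewrite ?ffunE.
have lift_max : ord_max = lift ord0 ord_max :> 'I_d.+2 by apply/val_inj.
transitivity (\sum_(q : {ffun 'I_d.+1 -> T} | q ord_max == z)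
    w d.+1 x (q ord0) *
    \prod_(k < d) w (d - k) (q (widen_ord (leqnSn d) k)) (q (lift ord0 k))).
  apply: eq_big => [q|q _].
    rewrite path_cons0 eqxx lift_max path_consS /=.
    suff -> : [ffun k => path_cons x q (lift ord0 k)] == q by rewrite andbT.
    by apply/eqP/ffunP => k; rewrite ffunE path_consS.
  rewrite big_ord_recl subn0.
  have -> : widen_ord (leqnSn d.+1) ord0 = ord0 by apply/val_inj.
  rewrite path_cons0 path_consS; congr (_ * _); apply: eq_bigr => k _.
  have -> : widen_ord (leqnSn d.+1) (lift ord0 k) =
            lift ord0 (widen_ord (leqnSn d) k) by apply/val_inj.
  by rewrite !path_consS.
(* [q ord0] is the second vertex of the original path. *)
rewrite (partition_big (fun q : {ffun 'I_d.+1 -> T} => q ord0) predT) //=.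
apply: eq_bigr => y _; rewrite big_distrr /=.
by apply: eq_big => [q|q /andP[_ /eqP ->]] //; rewrite andbC.
Qed.

End PathSums.

Section IncreasingSums.

Variables (R : comPzSemiRingType) (t : nat -> nat -> R) (b : nat).

(** The heights of the falls are [y, y - 1, ...], and the entry at height [h]
must be smaller than [h]. The lower bound [lo] is what makes a recursion
possible. The alphabet [b] is independent of [y] because [y] decreases along
the recursion while the type of the entries has to stay the same. *)
Definition increasing_sum (m y lo : nat) : R :=
  \sum_(a : m.-tuple 'I_b | path leq lo [seq val x | x <- a] &&
       [forall s : 'I_m, nth 0 [seq val x | x <- a] s < y - s]%N)
    \prod_(s < m) t (y - s) (nth 0 [seq val x | x <- a] s).

Lemma increasing_sum0 y lo : increasing_sum 0 y lo = 1.
Proof.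
rewrite /increasing_sum (big_pred1 [tuple]) ?big_ord0 // => a.
by rewrite tuple0 [RHS]/= [RHS]eqxx; apply/forallP => -[].
Qed.

(** Once the first entry [c] is removed, weak monotonicity of the remaining
sequence says that its entries are bounded below by [c]. *)
Lemma increasing_sumS m y lo :
  increasing_sum m.+1 y lo =
  \sum_(c < b | (lo <= c < y)%N) t y c * increasing_sum m y.-1 c.
Proof.
under eq_bigr do rewrite /increasing_sum big_distrr.
rewrite pair_big_dep /= /increasing_sum.
rewrite (reindex (fun u : 'I_b * m.-tuple 'I_b => [tuple of u.1 :: u.2])) /=;
  last first.
  exists (fun a => (thead a, [tuple of behead a])) => [[c a] _ | a _] /=.
    by congr pair; apply/val_inj.
  by rewrite -tuple_eta.
apply: eq_big => [[c a]|[c a] _] /=; last first.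
  rewrite big_ord_recl subn0 /=; congr (_ * _); apply: eq_bigr => s _ /=.
  by rewrite -subn1 -subnDA.
rewrite -!andbA; congr andb; rewrite andbCA; congr andb.
apply/forallP/andP => [H|[H0 /forallP H] s].
  split; first by have := H ord0; rewrite subn0.
  by apply/forallP => s; have := H (lift ord0 s); rewrite lift0 /=; lia.
case: (unliftP ord0 s) => [s'|] ->; last by rewrite subn0.
by have := H s'; rewrite lift0 /=; lia.
Qed.

Lemma increasing_sum_ge m y lo : (y <= lo)%N -> increasing_sum m.+1 y lo = 0.
Proof. by move=> yl; rewrite increasing_sumS big_pred0 // => c; lia. Qed.

(** The first entry either is [lo] or is at least [lo.+1]; the other entries
follow by monotonicity. *)
Lemma increasing_sum_split m y lo : (lo < y)%N -> (y <= b)%N ->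
  increasing_sum m.+1 y lo =
  increasing_sum m.+1 y lo.+1 + t y lo * increasing_sum m y.-1 lo.
Proof.
move=> ly yb; have lb := leq_trans ly yb.
rewrite !increasing_sumS (bigD1 (Ordinal lb)) /=; last by rewrite leqnn.
rewrite addrC; congr (_ + _); apply: eq_bigl => c.
by rewrite -val_eqE /=; lia.
Qed.

End IncreasingSums.

Section Edges.

Variables (R : comPzSemiRingType) (t : nat -> nat -> R).

(** Illegal steps get weight 0, so that the sum over the admissible paths is a
sum over all sequences of heights. With [d = n - k] remaining steps, the index
[k + y - n] of a fall is [y - d]. *)
Definition edge (d y y' : nat) : R :=
  if y'.+1 == y then (if (d <= y)%N then t y (y - d) else 0) else (y' == y)%:R.

Lemma sum_edge n d (y : 'I_n.+1) (F : 'I_n.+1 -> R) :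
  \sum_(y' < n.+1) edge d y y' * F y' =
  F y + (if (0 < y)%N && (d <= y)%N then t y (y - d) * F (inord y.-1) else 0).
Proof.
rewrite (bigD1 y) //= {1}/edge gtn_eqF // eqxx mul1r; congr (_ + _).
have [y0|y0] /= := posnP y.
  rewrite big1 // => y'; rewrite -val_eqE /edge /= => /negbTE ->.
  by rewrite y0 mul0r.
have yE : (inord y.-1 : 'I_n.+1) = y.-1 :> nat.
  by rewrite inordK // (leq_ltn_trans (leq_pred y)).
rewrite (bigD1 (inord y.-1)) /=; last by rewrite -val_eqE /= yE; lia.
rewrite /edge yE prednK // eqxx big1 ?addr0; first by case: ifP; rewrite ?mul0r.
move=> y' /andP[]; rewrite -!val_eqE /= yE => /negbTE -> h.
by rewrite ifN ?mul0r //; lia.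
Qed.

(** The lower bound [y - d] is the value that a fall made at once would record;
any later fall records at least as much. *)
Lemma path_sum_edge n b d (y j : 'I_n.+1) : (y <= b)%N ->
  path_sum (fun d (x x' : 'I_n.+1) => edge d x x') d y j =
  if (j <= y)%N then increasing_sum t b (y - j) y (y - d) else 0.
Proof.
elim: d y => [|d IHd] y yb.
  rewrite path_sum0 subn0 -val_eqE /=.
  case: (ltngtP j y) => // [jy|->]; last by rewrite subnn increasing_sum0.
  (* Falls are still needed but no step remains; on the other side, the first
     entry would have to be at least [y] and smaller than [y]. *)
  by rewrite -(prednK (n := y - j)) ?subn_gt0 // increasing_sum_ge.
rewrite path_sumS sum_edge IHd //.
have [y0|y0] /= := posnP y; first by rewrite y0 !sub0n addr0.
have yE : (inord y.-1 : 'I_n.+1) = y.-1 :> nat.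
  by rewrite inordK // (leq_ltn_trans (leq_pred y)).
rewrite IHd yE; last exact: leq_trans (leq_pred _) yb.
case: (ltngtP j y) => [jy|jy|jy]; last 2 first.
- rewrite (_ : (j <= y.-1)%N = false); last lia.
  by rewrite mulr0 if_same addr0.
- rewrite jy subnn !increasing_sum0 (_ : (y <= y.-1)%N = false) ?mulr0; last lia.
  by rewrite if_same addr0.
have -> : (j <= y.-1)%N by lia.
rewrite (_ : y - j = (y.-1 - j).+1)%N; last lia.
case: leqP => dy; last first.
  have -> : (y.-1 - d = y - d.+1)%N by lia.
  rewrite [RHS]increasing_sum_split //; last lia.
  by rewrite subnSK.
(* Here both truncated differences vanish: only the horizontal step is legal,
   and the lower bound 0 stays 0. *)
by rewrite addr0 (_ : y - d = y - d.+1)%N //; lia.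
Qed.

End Edges.

Lemma Lmx_path_sum (R : realType) (t : nat -> nat -> R) n (i j : 'I_n.+1) :
  Lmx t n i j = path_sum (fun d (x x' : 'I_n.+1) => edge t d x x') n i j.
Proof.
rewrite mxE /path_sum [RHS](bigID (mem (Lpaths i j))) /= [X in _ = _ + X]big1.
  rewrite addr0; apply: eq_big => [p|p].
    by rewrite inE; do 2 case: eqP.
  rewrite inE => /and4P[_ _ /forallP hf /forallP ge].
  apply: eq_bigr => k _; move: (hf k) (ge k).
  rewrite /step_weight /horizontal /fall /edge.
  rewrite -/(htgt p k) -/(hsrc p k).
  case: (_.+1 =P _) => [_ _ /= le|_]; last by rewrite orbF => ->.
  by rewrite le; congr t; have := ltn_ord k; lia.
(* A sequence of heights with the right ends that is not an admissible path has
   a step of weight 0. *)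
move=> p /andP[/andP[p0 pn]]; rewrite inE p0 pn /= negb_and !negb_forall.
move=> /orP[] /existsP[k hk]; rewrite (bigD1 k) //=;
  rewrite /edge -/(htgt p k) -/(hsrc p k).
  by move: hk; rewrite negb_or => /andP[/negbTE h /negbTE f];
    rewrite -/(fall p k) f -/(horizontal p k) h mul0r.
move: hk; rewrite negb_imply => /andP[f /negbTE le].
by rewrite -/(fall p k) f le mul0r.
Qed.

Lemma QI_increasing_sum (R : realType) (t : nat -> nat -> R) (i j : nat) :
  (j <= i)%N ->
  \sum_(a in QI i j) \prod_(j <= r < i) t r.+1 (entry a (i - r)) =
  increasing_sum t i (i - j) i 0.
Proof.
move=> ji; apply: eq_big => [a|a _].
  rewrite inE ji /=; congr andb; first by case: [seq _ | _ <- a].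
  by apply: eq_forallb => s; rewrite /entry /=; have := ltn_ord s; lia.
(* The factor of index [r] belongs to the entry of 0-based index [i - r - 1]:
   the two products run in opposite directions. *)
rewrite -{1}(add0n j) big_addn big_nat_rev big_mkord; apply: eq_bigr => s _.
by rewrite /entry add0n; have := ltn_ord s => hs; congr (t _ (nth _ _ _)); lia.
Qed.

Theorem theorem3p4 (R : realType) (t : nat -> nat -> R) (n : nat)
    (hn : (1 <= n)%N) (i j : 'I_n.+1) :
  Lmx t n i j =
  \sum_(a in QI i j) \prod_(j <= r < i) t r.+1 (entry a (i - r)).
Proof.
rewrite Lmx_path_sum (path_sum_edge _ (b := i)) //.
case: leqP => [ji|ij]; last first.
  by rewrite big_pred0 // => a; rewrite inE leqNgt ij.
rewrite QI_increasing_sum //; congr increasing_sum.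
by have := ltn_ord i; lia.
Qed.
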